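(* For any $k\ge0$, the $k$th degree normalized discrete B-spline (DB-spline) basis functions $N^k_1,\ldots,N^k_n$ have the following support structure: $N^k_j$ is supported on $$\begin{cases}[a,x_{j+k}]&\text{if }j\le k+1,\\ [x_{j-1},x_{j+k}]&\text{if }k+2\le j\le n-k-1,\\ [x_{j-1},b]&\text{if }j\ge n-k.\end{cases}$$ Furthermore, for each $j=1,\ldots,n$, we have the explicit expansion in the falling factorial basis $$N^k_j=\sum_{i=j}^{\min\{j+k+1,n\}}(\mathbb{Z}^{k+1}_n\mathbb{B}^{k+1}_n)_{ij}\cdot h^k_i.$$
   Context: Here $k$ is an integer. Design points: $a\le x_1<\cdots<x_n\le b$, with the notational convention $x_{n+1}=b$. Empty products equal 1. ''Supported on $C$'' means zero outside $C$. Falling factorial basis on $[a,b]$: $h^k_j(x)=\frac1{(j-1)!}\prod_{\ell=1}^{j-1}(x-x_\ell)$ for $j=1,\ldots,k+1$, and $h^k_j(x)=\frac1{k!}\prod_{\ell=j-k}^{j-1}(x-x_\ell)\cdot1\{x>x_{j-1}\}$ for $j=k+2,\ldots,n$. Let $\mathcal{H}^k_n=\mathrm{span}\{h^k_1,\ldots,h^k_n\}$ (the $n$-dimensional space of $k$th degree discrete splines on $[a,b]$ with knots $x_{k+1},\ldots,x_{n-1}$). The normalized DB-spline $N^k_j$ is the unique function in $\mathcal{H}^k_n$ with $N^k_j(x_i)=\delta_{ij}$ for $i=1,\ldots,n$, where $\delta_{ij}=1$ if $i=j$ and $\delta_{ij}=0$ otherwise. Matrices: for $d\ge1$, $\mathbb{Z}^d_n\in\mathbb{R}^{n\times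 n}$ is the diagonal matrix with diagonal $\big(1,\ldots,1,\frac{x_{d+1}-x_1}{d},\ldots,\frac{x_n-x_{n-d}}{d}\big)$ (with $d$ ones), and $\overline{\mathbb{B}}_{n,d}\in\mathbb{R}^{n\times n}$ is defined by $(\overline{\mathbb{B}}_{n,d}v)_i=v_i$ for $i\le d$ and $(\overline{\mathbb{B}}_{n,d}v)_i=v_i-v_{i-1}$ for $i>d$. The extended discrete derivative matrices are $\mathbb{B}^1_n=(\mathbb{Z}^1_n)^{-1}\overline{\mathbb{B}}_{n,1}$ and $\mathbb{B}^d_n=(\mathbb{Z}^d_n)^{-1}\overline{\mathbb{B}}_{n,d}\,\mathbb{B}^{d-1}_n$ for $d\ge2$.
   Formalization: The first and last support cases are taken as mutually exclusive: the first also requires j < n-k and the last also j > k+1 (automatic if n ≥ 2k+2), since for an index j in both cases the stated support can be false or undefined. *)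

(* Defs.v *)
From HB Require Import structures.
From mathcomp Require Import all_boot all_order all_algebra.
Set Implicit Arguments.
Unset Strict Implicit.
Unset Printing Implicit Defensive.
Import Order.TTheory GRing.Theory Num.Theory.
Local Open Scope ring_scope.

(* Design points are given by a sequence x : nat -> R read from index 1: only  *)
(* x 1, ..., x n are constrained, and in formulas indices have their usual     *)
(* 1-based values.  Row and column i : 'I_n of a matrix therefore correspond   *)
(* to the mathematical index i.+1.  A function on [a, b] is represented by a   *)
(* total function R -> R that is only considered on [a, b].                    *)

Definition design_points (R : realFieldType) (a b : R) (n : nat)
    (x : nat -> R) : Prop :=
  [/\ a <= x 1%N,
      forall i : nat, (1 <= i < n)%N -> x i < x i.+1
    & x n <= b].

Definition falling_factorial_basis (R : realFieldType) (x : nat -> R) (k j : nat)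
    (t : R) : R :=
  if (j <= k.+1)%N then
    ((j.-1)`!%:R)^-1 * \prod_(1 <= l < j) (t - x l)
  else
    (k`!%:R)^-1 * (\prod_(j - k <= l < j) (t - x l)) * (x j.-1 < t)%R%:R.

Definition discrete_spline (R : realFieldType) (a b : R) (n : nat)
    (x : nat -> R) (k : nat) (f : R -> R) : Prop :=
  exists c : nat -> R, forall t : R, t \in `[a, b] ->
    f t = \sum_(1 <= i < n.+1) c i * falling_factorial_basis x k i t.

(* By dbspline_exists and dbspline_unique below, this determines exactly one   *)
(* function on [a, b].                                                         *)
Definition is_dbspline (R : realFieldType) (a b : R) (n : nat)
    (x : nat -> R) (k j : nat) (f : R -> R) : Prop :=
  discrete_spline a b n x k f /\
  forall i : nat, (1 <= i <= n)%N -> f (x i) = (i == j)%:R.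

Definition supported_on (R : realFieldType) (a b : R) (f : R -> R)
    (C : interval R) : Prop :=
  forall t : R, t \in `[a, b] -> t \notin C -> f t = 0.

Definition Zmx (R : realFieldType) (x : nat -> R) (n d : nat) : 'M[R]_n :=
  diag_mx (\row_(i < n)
    if (i < d)%N then 1 else (x i.+1 - x (i.+1 - d)%N) / d%:R).

Definition Bbar (R : realFieldType) (n d : nat) : 'M[R]_n :=
  \matrix_(i < n, j < n)
    ((i == j)%:R - ((d <= i)%N && (i == j.+1 :> nat))%:R).

(* Order 0 is the identity, so that order 1 is (Zmx x n 1)^-1 * Bbar n 1.      *)
Fixpoint ext_discrete_deriv (R : realFieldType) (x : nat -> R) (n d : nat) :
    'M[R]_n :=
  if d is d'.+1 then
    invmx (Zmx x n d) *m Bbar R n d *m ext_discrete_deriv x n d'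
  else 1%:M.

Lemma Bbar_mulE (R : realFieldType) (n d : nat) (v : 'cV[R]_n.+1)
    (i : 'I_n.+1) : (1 <= d)%N ->
  (Bbar R n.+1 d *m v) i 0 =
    if (i < d)%N then v i 0 else v i 0 - v (inord i.-1) 0.
Proof.
move=> d_gt0; rewrite mxE.
under eq_bigr => j _ do rewrite mxE mulrBl.
rewrite big_split /= (bigD1 i) //= eqxx mul1r big1 ?addr0; last first.
  by move=> j ji; rewrite eq_sym (negPf ji) mul0r.
rewrite sumrN; case: ltnP => [id|di].
  by rewrite big1 ?subr0 // => j _; rewrite /= mul0r.
have i_gt0 : (0 < i)%N := leq_trans d_gt0 di.
have lt_i : (i.-1 < n.+1)%N by rewrite (leq_ltn_trans (leq_pred i)).
rewrite (bigD1 (inord i.-1)) //= inordK // prednK // eqxx mul1r big1 ?addr0 //.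
move=> j ji; case: eqP => [ij|]; last by rewrite mul0r.
by case/eqP: ji; apply: val_inj; rewrite /= inordK // ij.
Qed.

Section DBsplineUnique.
Variables (R : realFieldType) (a b : R) (n : nat) (x : nat -> R) (k : nat).
Hypothesis xP : design_points a b n x.

Let x_lt (i j : nat) : (1 <= i)%N -> (i < j)%N -> (j <= n)%N -> x i < x j.
Proof.
case: xP => _ xS _ i_gt0; elim: j => // j IHj; rewrite ltnS leq_eqVlt.
case/predU1P => [<- lt_n|lt_ij lt_n]; first by apply: xS; rewrite i_gt0.
apply: lt_trans (IHj lt_ij (ltnW lt_n)) _.
by apply: xS; rewrite lt_n (leq_ltn_trans _ lt_ij).
Qed.

Let x_ab (i : nat) : (1 <= i <= n)%N -> x i \in `[a, b].
Proof.
case: xP => ax _ xb /andP[i_gt0 le_n]; rewrite in_itv /=; apply/andP; split.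
  move: i_gt0 le_n; rewrite leq_eqVlt => /predU1P[<- //|i1 le_n].
  exact: le_trans ax (ltW (x_lt _ i1 le_n)).
move: le_n; rewrite leq_eqVlt => /predU1P[-> //|lt_n].
exact: le_trans (ltW (x_lt i_gt0 lt_n _)) xb.
Qed.

Let H : 'M[R]_n := \matrix_(i, j) falling_factorial_basis x k j.+1 (x i.+1).

Let H_unit : H \in unitmx.
Proof.
have Htrig : is_trig_mx H.
  apply/is_trig_mxP => i j lt_ij; rewrite mxE /falling_factorial_basis.
  case: ifP => _.
    apply/eqP; rewrite mulf_eq0 prodf_seq_eq0; apply/orP; right.
    by apply/hasP; exists i.+1; rewrite ?mem_index_iota ?subrr ?eqxx.
  suff /negPf-> : ~~ (x j.+1.-1 < x i.+1) by rewrite mulr0.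
  rewrite -leNgt /=; move: lt_ij; rewrite leq_eqVlt => /predU1P[<- //|lt_ij].
  by rewrite ltW // x_lt // ltnW.
rewrite unitmxE det_trig // unitfE; apply/prodf_neq0 => i _.
rewrite mxE /falling_factorial_basis.
have fact_neq0 m : ((m`!)%:R : R)^-1 != 0.
  by rewrite invr_eq0 pnatr_eq0 -lt0n fact_gt0.
have prod_neq0 m : (0 < m)%N -> \prod_(m <= l < i.+1) (x i.+1 - x l) != 0.
  move=> m_gt0; rewrite big_seq prodf_seq_neq0; apply/allP => l.
  rewrite mem_index_iota => /andP[ml li]; apply/implyP => _.
  by rewrite subr_eq0 gt_eqF // x_lt // (leq_trans m_gt0).
case: ifP => [_|/negbT]; first by rewrite mulf_neq0 ?prod_neq0.
rewrite -ltnNge ltnS => lt_ki.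
rewrite !mulf_neq0 ?prod_neq0 ?subn_gt0 //; first by rewrite ltnS ltnW.
by rewrite x_lt ?oner_neq0 // (leq_trans _ lt_ki).
Qed.

Lemma dbspline_exists (j : nat) : exists f : R -> R, is_dbspline a b n x k j f.
Proof.
pose v : 'cV[R]_n := \col_i (i.+1 == j)%:R.
pose c := invmx H *m v.
pose c' (i : nat) := if insub i.-1 is Some i' then c i' 0 else 0.
exists (fun t => \sum_(1 <= i < n.+1) c' i * falling_factorial_basis x k i t).
split=> [|[//|i] /= lt_in]; first by exists c'.
have /matrixP/(_ (Ordinal lt_in) 0) : H *m c = v by rewrite mulKVmx.
rewrite !mxE /= => <-; rewrite big_add1 big_mkord; apply: eq_bigr => l _.
by rewrite mxE /c' /= valK mulrC.
Qed.

Lemma dbspline_unique (j : nat) (f g : R -> R) :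
    is_dbspline a b n x k j f -> is_dbspline a b n x k j g ->
  {in `[a, b], f =1 g}.
Proof.
move=> [[c fE] fx] [[d gE] gx] t tab.
have e : (\col_(i < n) c i.+1 : 'cV[R]_n) = \col_i d i.+1.
  apply: (can_inj (mulKmx H_unit)); apply/colP => i; rewrite !mxE.
  have i1n : (1 <= i.+1 <= n)%N by rewrite /= ltn_ord.
  have := etrans (fx _ i1n) (esym (gx _ i1n)).
  rewrite fE ?x_ab // gE ?x_ab // !big_add1 !big_mkord /= => fg.
  rewrite (eq_bigr (fun l : 'I_n => c l.+1 * falling_factorial_basis x k l.+1 (x i.+1))).
    rewrite fg; apply: eq_bigr => l _; by rewrite !mxE mulrC.
  by move=> l _; rewrite !mxE mulrC.
rewrite fE // gE // !big_add1 !big_mkord; apply: eq_bigr => l _.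
by have /colP/(_ l) := e; rewrite !mxE => ->.
Qed.

End DBsplineUnique.

(* Main.v *)
Require Import Defs.
From mathcomp Require Import all_boot all_order all_algebra.
From mathcomp Require Import zify ring.
Import Order.TTheory GRing.Theory Num.Theory.
Local Open Scope ring_scope.
Set Implicit Arguments.
Unset Strict Implicit.

(** Write H^k for the collocation matrix with entries h^k_j (x_i).  A spline
with coefficient vector c takes the values H^k c at the design points, so the
coefficients of N^k_j are the jth column of the inverse of H^k, and the
expansion amounts to two facts about A = Z^{k+1} B^{k+1}: it is the inverse of
H^k, and it is banded.

Since Z^{k+1} cancels, A = Bbar_{k+1} B^k, and H^k A = 1 is proved by induction
on k.  The induction rests on the Newton-type identity
  h^{k+1}_j - h^{k+1}_{j+1} = h^k_j (x_j - x_{j-k-1}) / (k+1),   j >= k+2,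
valid at the design points ([falling_factorial_diff]); it says that
H^{k+1} Bbar_{k+2} = H^k Z^{k+1} ([collocation_Bbar_step]), so
H^{k+1} Bbar_{k+2} B^{k+1} telescopes down to H^k Bbar_{k+1} B^k, and finally
to H^0 Bbar_1 = 1.  Bandedness holds because each factor Bbar adds one
subdiagonal and each factor Z is diagonal.

For the support, only the terms h_i with j <= i <= j+k+1 matter.  To the left
of x_{j-1}, when j >= k+2, all their indicators vanish.  To the right of
x_{j+k}, when j+k+1 <= n, all their indicators equal 1, so N^k_j coincides
there with a polynomial of degree at most k; that polynomial also agrees with
N^k_j, hence vanishes, at the k+1 points x_{j+1}, ..., x_{j+k+1}, so it is 0
([dbspline_eq0_right]). *)

(** * Falling factorial functions at the design points *)

Lemma design_points_lt (R : realFieldType) (a b : R) (n : nat) (x : nat -> R)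
    (i j : nat) :
  design_points a b n x -> (0 < i)%N -> (i < j)%N -> (j <= n)%N -> x i < x j.
Proof.
case=> _ xS _ i_gt0; elim: j => // j IHj; rewrite ltnS leq_eqVlt.
case/predU1P => [<- lt_n|lt_ij lt_n]; first by apply: xS; rewrite i_gt0.
apply: lt_trans (IHj lt_ij (ltnW lt_n)) _.
by apply: xS; rewrite lt_n (leq_ltn_trans _ lt_ij).
Qed.

Lemma design_points_le (R : realFieldType) (a b : R) (n : nat) (x : nat -> R)
    (i j : nat) :
  design_points a b n x -> (0 < i)%N -> (i <= j)%N -> (j <= n)%N -> x i <= x j.
Proof.
move=> xP i_gt0; rewrite leq_eqVlt => /predU1P[-> //|lt_ij le_n].
exact/ltW/(design_points_lt xP).
Qed.

Lemma design_points_inj (R : realFieldType) (a b : R) (n : nat) (x : nat -> R) :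
  design_points a b n x -> {in [pred i | 0 < i <= n]%N &, injective x}.
Proof.
move=> xP i j; rewrite !inE => i_bd j_bd eq_x.
case: (ltngtP i j) => // [lt_ij|lt_ji].
  suff: x i < x j by rewrite eq_x ltxx.
  by apply: (design_points_lt xP); lia.
suff: x j < x i by rewrite eq_x ltxx.
by apply: (design_points_lt xP); lia.
Qed.

Lemma design_points_itv (R : realFieldType) (a b : R) (n : nat) (x : nat -> R)
    (i : nat) :
  design_points a b n x -> (0 < i <= n)%N -> x i \in `[a, b].
Proof.
move=> xP /andP[i_gt0 le_n]; have [ax _ xb] := xP; rewrite in_itv /=.
rewrite (le_trans ax) ?(design_points_le xP) //=.
by apply: le_trans xb; apply: (design_points_le xP).
Qed.

(** The index i = n+1 is included: it is what makes the last column of the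
collocation matrix obey the same recursion as the others. *)
Lemma falling_factorial_eq0 (R : realFieldType) (a b : R) (n : nat)
    (x : nat -> R) (k m i : nat) :
  design_points a b n x -> (0 < m)%N -> (m < i)%N -> (i <= n.+1)%N ->
  falling_factorial_basis x k i (x m) = 0.
Proof.
move=> xP m_gt0 lt_mi le_in; rewrite /falling_factorial_basis; case: ifP => _.
  rewrite (@big_cat_nat _ _ _ m) //=; last exact: ltnW.
  by rewrite [X in _ * (_ * X)]big_ltn // subrr mul0r !mulr0.
rewrite ltNge (design_points_le xP) ?mulr0 //; lia.
Qed.

(** The two neighbouring products of degree k+1 share all the factors of the
product of degree k, and the two remaining factors t - x_{j-k-1} and t - x_j
differ by a constant.  The indicators do not match off the design points; at
x_m either m < j and all three terms vanish, or m >= j and the indicators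
equal 1, except when m = j, where the middle term vanishes anyway. *)
Lemma falling_factorial_diff (R : realFieldType) (a b : R) (n : nat)
    (x : nat -> R) (k m j : nat) :
  design_points a b n x -> (0 < m <= n)%N -> (k.+1 < j <= n)%N ->
  falling_factorial_basis x k.+1 j (x m)
    - falling_factorial_basis x k.+1 j.+1 (x m)
  = falling_factorial_basis x k j (x m) * ((x j - x (j - k.+1)%N) / k.+1%:R).
Proof.
move=> xP /andP[m_gt0 le_mn] /andP[lt_kj le_jn].
have [lt_mj|le_jm] := ltnP m j.
  have eq0 d i : (j <= i <= n.+1)%N -> falling_factorial_basis x d i (x m) = 0.
    by move=> i_bd; apply: (falling_factorial_eq0 d xP); lia.
  by rewrite !eq0 ?mul0r ?subr0 //; lia.
have lt_pred : x j.-1 < x m by apply: (design_points_lt xP) => //; lia.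
rewrite /falling_factorial_basis.
have -> : (j <= k.+1)%N = false by lia.
have -> : (j.+1 <= k.+2)%N = false by lia.
set P := \prod_(j - k <= l < j) (x m - x l).
have P_first : \prod_(j - k.+1 <= l < j) (x m - x l)
    = (x m - x (j - k.+1)%N) * P.
  rewrite big_ltn; last by lia.
  by have -> : (j - k.+1).+1 = (j - k)%N by lia.
have P_last : \prod_(j.+1 - k.+1 <= l < j.+1) (x m - x l) * (x j < x m)%R%:R
    = P * (x m - x j).
  rewrite subSS big_nat_recr /= ?leq_subr //.
  move: le_jm; rewrite leq_eqVlt => /predU1P[<-|lt_jm].
    by rewrite subrr !mulr0 mul0r.
  by rewrite (design_points_lt xP) ?mulr1 //; lia.
rewrite lt_pred !mulr1 -[_ * _ * (x j.+1.-1 < _)%R%:R]mulrA P_last P_first.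
have -> : (if (j <= k.+2)%N
     then (j.-1`!%:R)^-1 * \prod_(1 <= l < j) (x m - x l)
     else (k.+1`!%:R)^-1 * ((x m - x (j - k.+1)%N) * P))
    = (k.+1`!%:R)^-1 * ((x m - x (j - k.+1)%N) * P) :> R.
  case: ifP => // le_j; have jE : j = k.+2 by lia.
  by rewrite -P_first jE /= subSS subSnn.
have fact_neq0 : k`!%:R != 0 :> R by rewrite pnatr_eq0 -lt0n fact_gt0.
have kS_neq0 : k.+1%:R != 0 :> R by rewrite pnatr_eq0.
rewrite factS natrM; field.
by rewrite fact_neq0 [1 + _]addrC natr1 kS_neq0.
Qed.

(** * The collocation matrix and its inverse *)

Definition collocation (R : realFieldType) (x : nat -> R) (n k : nat) :
    'M[R]_n :=
  \matrix_(i, j) falling_factorial_basis x k j.+1 (x i.+1).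

Lemma sum_mul_Bbar (R : realFieldType) (n d : nat) (F : nat -> R) (j : 'I_n) :
  F n = 0 ->
  \sum_(l < n) F l * Bbar R n d l j
  = F j - (if (d <= j.+1)%N then F j.+1 else 0).
Proof.
move=> Fn0; under eq_bigr => l _ do rewrite mxE mulrBr.
rewrite sumrB; congr (_ - _).
  rewrite (bigD1 j) //= eqxx mulr1 big1 ?addr0 // => l /negPf->.
  by rewrite mulr0.
have [lt_jn|le_nj] := ltnP j.+1 n; last first.
  have -> : j.+1 = n by apply/eqP; rewrite eqn_leq ltn_ord.
  rewrite Fn0 if_same big1 // => l _.
  by rewrite (ltn_eqF (ltn_ord l)) andbF mulr0.
rewrite (bigD1 (Ordinal lt_jn)) //= eqxx andbT big1 ?addr0 => [|l ne_l].
  by case: ifP; rewrite ?mulr1 ?mulr0.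
suff /negPf-> : (l != j.+1 :> nat)%N by rewrite andbF mulr0.
by apply: contra ne_l => /eqP lE; apply/eqP/val_inj.
Qed.

Lemma collocation_BbarE (R : realFieldType) (a b : R) (n : nat) (x : nat -> R)
    (k d : nat) (i j : 'I_n) :
  design_points a b n x ->
  (collocation x n k *m Bbar R n d) i j
  = falling_factorial_basis x k j.+1 (x i.+1)
    - (if (d <= j.+1)%N then falling_factorial_basis x k j.+2 (x i.+1) else 0).
Proof.
move=> xP; rewrite mxE.
under eq_bigr => l _ do rewrite [collocation _ _ _ _ _]mxE.
rewrite (@sum_mul_Bbar _ _ _
  (fun l => falling_factorial_basis x k l.+1 (x i.+1))) //.
by rewrite (falling_factorial_eq0 k xP) ?ltnS ?ltn_ord.
Qed.

Lemma collocation0_Bbar (R : realFieldType) (a b : R) (n : nat)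
    (x : nat -> R) :
  design_points a b n x -> collocation x n 0 *m Bbar R n 1 = 1%:M.
Proof.
move=> xP; apply/matrixP => i j; rewrite (collocation_BbarE _ _ _ _ xP) mxE /=.
have step l : (l <= n)%N ->
    falling_factorial_basis x 0 l.+1 (x i.+1) = (l <= i)%N%:R.
  move=> le_ln; have [le_li|lt_il] := leqP l i; last first.
    by rewrite (falling_factorial_eq0 0 xP).
  rewrite /falling_factorial_basis; case: ifP => [l1|/negbT].
    have -> : l = 0%N by lia.
    by rewrite big_geq // fact0 invr1 mulr1.
  rewrite -ltnNge subn0 big_geq // fact0 invr1 !mul1r /= => l_gt0.
  by rewrite (design_points_lt xP).
rewrite !step ?(ltnW (ltn_ord j)) ?ltn_ord // -val_eqE /=.
by case: ltngtP => // _; rewrite ?subrr ?subr0.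
Qed.

Lemma collocation_Bbar_step (R : realFieldType) (a b : R) (n : nat)
    (x : nat -> R) (k : nat) :
  design_points a b n x ->
  collocation x n k.+1 *m Bbar R n k.+2 = collocation x n k *m Zmx x n k.+1.
Proof.
move=> xP; apply/matrixP => i j; rewrite (collocation_BbarE _ _ _ _ xP).
rewrite mul_mx_diag !mxE !ltnS; have [lt_kj|le_jk] := ltnP k j.
  by rewrite (falling_factorial_diff xP) // ?ltnS ?lt_kj ltn_ord.
rewrite subr0 mulr1 /falling_factorial_basis.
by rewrite !ltnS le_jk (leqW le_jk).
Qed.

Lemma Zmx_unit (R : realFieldType) (a b : R) (n : nat) (x : nat -> R)
    (d : nat) :
  design_points a b n x -> (0 < d)%N -> Zmx x n d \in unitmx.
Proof.
move=> xP d_gt0; rewrite unitmxE det_diag unitfE; apply/prodf_neq0 => i _.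
rewrite mxE; case: ltnP => [_|le_di]; first exact: oner_neq0.
have lt_x : x (i.+1 - d)%N < x i.+1.
  by have lt_in := ltn_ord i; apply: (design_points_lt xP); lia.
by rewrite mulf_neq0 ?invr_eq0 ?pnatr_eq0 -?lt0n // subr_eq0 gt_eqF.
Qed.

Lemma Zmx_mul_deriv (R : realFieldType) (a b : R) (n : nat) (x : nat -> R)
    (k : nat) :
  design_points a b n x ->
  Zmx x n k.+1 *m ext_discrete_deriv x n k.+1
  = Bbar R n k.+1 *m ext_discrete_deriv x n k.
Proof.
by move=> xP; rewrite /= -mulmxA (mulKVmx (Zmx_unit (d := k.+1) xP isT)).
Qed.

Lemma collocation_ext_discrete_deriv (R : realFieldType) (a b : R) (n : nat)
    (x : nat -> R) (k : nat) :
  design_points a b n x ->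
  collocation x n k *m Bbar R n k.+1 *m ext_discrete_deriv x n k = 1%:M.
Proof.
move=> xP; elim: k => [|k IHk]; first by rewrite (collocation0_Bbar xP) mulmx1.
by rewrite (collocation_Bbar_step k xP) -mulmxA (Zmx_mul_deriv k xP) mulmxA.
Qed.

Lemma Zmx_deriv_collocation (R : realFieldType) (a b : R) (n : nat)
    (x : nat -> R) (k : nat) :
  design_points a b n x ->
  (Zmx x n k.+1 *m ext_discrete_deriv x n k.+1) *m collocation x n k = 1%:M.
Proof.
move=> xP; rewrite (Zmx_mul_deriv k xP); apply: mulmx1C.
by rewrite mulmxA (collocation_ext_discrete_deriv k xP).
Qed.

(** * Bandedness *)

Lemma Bbar_mul_band (R : realFieldType) (n d e : nat) (M : 'M[R]_n) :
  (forall i j : 'I_n, ~~ (j <= i <= j + e)%N -> M i j = 0) ->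
  forall i j : 'I_n, ~~ (j <= i <= j + e.+1)%N -> (Bbar R n d *m M) i j = 0.
Proof.
move=> M0 i j ij; rewrite mxE big1 // => l _; rewrite mxE.
have [lj|lj] := boolP (j <= l <= j + e)%N; last by rewrite M0 ?mulr0.
have -> : (i == l) = false by apply/eqP => il; move: ij; rewrite il; lia.
have -> : (i == l.+1 :> nat) = false by lia.
by rewrite andbF subrr mul0r.
Qed.

Lemma ext_discrete_deriv_band (R : realFieldType) (a b : R) (n : nat)
    (x : nat -> R) (d : nat) :
  design_points a b n x -> forall i j : 'I_n,
  ~~ (j <= i <= j + d)%N -> ext_discrete_deriv x n d i j = 0.
Proof.
move=> xP; elim: d => [|d IHd] i j ij.
  by rewrite mxE; case: eqP => // ijE; move: ij; rewrite ijE; lia.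
(* As Z is diagonal with nonzero entries, Z *m M and M have the same zeros;
   this replaces computing the entries of invmx Z. *)
have := Zmx_mul_deriv d xP; move/matrixP/(_ i j).
rewrite (Bbar_mul_band _ IHd) // mul_diag_mx mxE => /eqP.
rewrite mulf_eq0 => /orP[Z0|/eqP //]; exfalso.
have := Zmx_unit (d := d.+1) xP isT; rewrite unitmxE det_diag unitfE.
by move/prodf_neq0/(_ i isT); rewrite Z0.
Qed.

Lemma Zmx_deriv_band (R : realFieldType) (a b : R) (n : nat) (x : nat -> R)
    (k : nat) (i j : 'I_n) :
  design_points a b n x -> ~~ (j <= i <= j + k.+1)%N ->
  (Zmx x n k.+1 *m ext_discrete_deriv x n k.+1) i j = 0.
Proof.
move=> xP ij; rewrite mul_diag_mx mxE.
by rewrite (ext_discrete_deriv_band xP) ?mulr0.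
Qed.

(** * Expansion and support of the normalized DB-splines *)

Lemma dbspline_expansion (R : realFieldType) (a b : R) (n : nat) (x : nat -> R)
    (k : nat) (j : 'I_n) (N : R -> R) :
  design_points a b n x -> is_dbspline a b n x k j.+1 N ->
  forall t : R, t \in `[a, b] ->
  N t = \sum_(i < n | (j <= i <= j + k.+1)%N)
          (Zmx x n k.+1 *m ext_discrete_deriv x n k.+1) i j *
          falling_factorial_basis x k i.+1 t.
Proof.
move=> xP [[c NE] Nx] t tab.
pose A := Zmx x n k.+1 *m ext_discrete_deriv x n k.+1.
pose v : 'cV[R]_n := \col_i c i.+1.
have Hv : collocation x n k *m v = delta_mx j 0.
  apply/colP => i; rewrite !mxE eqxx andbT -val_eqE /=.
  have /Nx : (1 <= i.+1 <= n)%N by rewrite /= ltn_ord.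
  rewrite NE ?(design_points_itv xP) //= big_add1 big_mkord /= eqSS => <-.
  by apply: eq_bigr => l _; rewrite !mxE mulrC.
have cE (i : 'I_n) : c i.+1 = A i j.
  have : v = A *m delta_mx j 0.
    by rewrite -Hv mulmxA (Zmx_deriv_collocation k xP) mul1mx.
  by move/colP/(_ i); rewrite -colE !mxE.
rewrite NE // big_add1 big_mkord /= [RHS]big_mkcond; apply: eq_bigr => i _.
rewrite cE; case: ifPn => // ij.
by rewrite (Zmx_deriv_band xP) ?mul0r.
Qed.

Lemma dbspline_eq0_left (R : realFieldType) (a b : R) (n : nat) (x : nat -> R)
    (k : nat) (j : 'I_n) (N : R -> R) (t : R) :
  design_points a b n x -> is_dbspline a b n x k j.+1 N ->
  (k < j)%N -> t \in `[a, b] -> t < x j -> N t = 0.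
Proof.
move=> xP NP lt_kj tab lt_t; rewrite (dbspline_expansion xP NP) //.
apply: big1 => i /andP[le_ji _]; rewrite /falling_factorial_basis.
have -> : (i.+1 <= k.+1)%N = false by lia.
rewrite /= ltNge (le_trans (ltW lt_t)) ?mulr0 //.
by rewrite (design_points_le xP) ?(ltnW (ltn_ord i)) // (leq_ltn_trans _ lt_kj).
Qed.

(** The polynomial that h^k_i equals wherever its indicator is 1. *)
Definition falling_factorial_poly (R : realFieldType) (x : nat -> R)
    (k i : nat) : {poly R} :=
  if (i <= k.+1)%N then (i.-1`!%:R)^-1 *: \prod_(1 <= l < i) ('X - (x l)%:P)
  else (k`!%:R)^-1 *: \prod_(i - k <= l < i) ('X - (x l)%:P).

Lemma size_falling_factorial_poly (R : realFieldType) (x : nat -> R)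
    (k i : nat) :
  (size (falling_factorial_poly x k i) <= k.+1)%N.
Proof.
rewrite /falling_factorial_poly; case: (leqP i k.+1) => ik;
  apply: leq_trans (size_scale_leq _ _) _;
  rewrite size_prod_XsubC size_iota; lia.
Qed.

Lemma falling_factorial_polyE (R : realFieldType) (x : nat -> R) (k i : nat)
    (t : R) :
  (i <= k.+1)%N || (x i.-1 < t) ->
  (falling_factorial_poly x k i).[t] = falling_factorial_basis x k i t.
Proof.
rewrite /falling_factorial_poly /falling_factorial_basis.
case: ifP => _ /= => [_|->]; rewrite ?mulr1 hornerZ horner_prod;
  by congr (_ * _); apply: eq_bigr => l _; rewrite hornerXsubC.
Qed.

(** At the knots x_{i-k}, ..., x_{i-1} the indicator may be dropped because the
product itself vanishes. *)
Lemma falling_factorial_poly_knot (R : realFieldType) (a b : R) (n : nat)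
    (x : nat -> R) (k i m : nat) :
  design_points a b n x -> (0 < m <= n)%N -> (0 < i <= n)%N -> (i - k <= m)%N ->
  (falling_factorial_poly x k i).[x m] = falling_factorial_basis x k i (x m).
Proof.
move=> xP /andP[m_gt0 le_mn] /andP[i_gt0 le_in] le_m.
rewrite /falling_factorial_poly /falling_factorial_basis.
case: ifPn => [_|ik]; rewrite hornerZ horner_prod.
  by congr (_ * _); apply: eq_bigr => l _; rewrite hornerXsubC.
have -> : \prod_(i - k <= l < i) ('X - (x l)%:P).[x m]
    = \prod_(i - k <= l < i) (x m - x l).
  by apply: eq_bigr => l _; rewrite hornerXsubC.
have [lt_mi|le_im] := ltnP m i; last first.
  by rewrite (design_points_lt xP) ?mulr1 //; lia.
rewrite (@big_cat_nat _ _ _ m) //=; last exact: ltnW.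
by rewrite [X in _ * (_ * X)]big_ltn // subrr mul0r !(mulr0, mul0r).
Qed.

Lemma dbspline_eq0_right (R : realFieldType) (a b : R) (n : nat) (x : nat -> R)
    (k : nat) (j : 'I_n) (N : R -> R) (t : R) :
  design_points a b n x -> is_dbspline a b n x k j.+1 N ->
  (j.+1 + k < n)%N -> t \in `[a, b] -> x (j.+1 + k)%N < t -> N t = 0.
Proof.
move=> xP NP lt_n tab lt_t; have NE := dbspline_expansion xP NP.
pose A := Zmx x n k.+1 *m ext_discrete_deriv x n k.+1.
pose p : {poly R} := \sum_(i < n | (j <= i <= j + k.+1)%N)
  A i j *: falling_factorial_poly x k i.+1.
have pN s : s \in `[a, b] ->
    (forall i : 'I_n, (j <= i <= j + k.+1)%N ->
      (falling_factorial_poly x k i.+1).[s]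
      = falling_factorial_basis x k i.+1 s) -> p.[s] = N s.
  move=> sab hE; rewrite NE // horner_sum; apply: eq_bigr => i ij.
  by rewrite hornerZ hE.
pose rs := [seq x m | m <- iota j.+2 k.+1].
have p0 : p = 0.
  apply: (roots_geq_poly_eq0 (rs := rs)).
  - apply/allP => s /mapP[m]; rewrite mem_iota => m_bd ->; apply/rootP.
    have m_n : (0 < m <= n)%N by lia.
    rewrite pN ?(design_points_itv xP) // => [|i ij].
      by case: NP => _ ->; rewrite //; have -> : (m == j.+1) = false by lia.
    have lt_in := ltn_ord i.
    by apply: (falling_factorial_poly_knot xP); lia.
  - rewrite map_inj_in_uniq ?iota_uniq // => m1 m2.
    rewrite !mem_iota => m1_bd m2_bd.
    by apply: (design_points_inj xP); rewrite inE; lia.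
  - rewrite size_map size_iota; apply: leq_trans (size_sum _ _ _) _.
    apply/bigmax_leqP => i _; apply: leq_trans (size_scale_leq _ _) _.
    exact: size_falling_factorial_poly.
rewrite -pN ?p0 ?horner0 // => i ij; apply: falling_factorial_polyE.
have [//|lt_ki] := leqP i.+1 k.+1.
by apply: le_lt_trans lt_t; apply: (design_points_le xP); rewrite //=; lia.
Qed.

Theorem lemma8 (R : realFieldType) (a b : R) (n : nat) (x : nat -> R)
    (hx : design_points a b n x) (k : nat) (j : 'I_n) (N : R -> R)
    (hN : is_dbspline a b n x k j.+1 N) :
  [/\ (j.+1 <= k + 1)%N -> (j.+1 < n - k)%N ->
        supported_on a b N `[a, x (j.+1 + k)%N],
      (k + 2 <= j.+1 <= n - k - 1)%N ->
        supported_on a b N `[x (j.+1 - 1)%N, x (j.+1 + k)%N],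
      (n - k <= j.+1)%N -> (k + 1 < j.+1)%N ->
        supported_on a b N `[x (j.+1 - 1)%N, b]
    & forall t : R, t \in `[a, b] ->
        N t = \sum_(i < n | (j.+1 <= i.+1 <= minn (j.+1 + k + 1) n)%N)
                (Zmx x n (k + 1) *m ext_discrete_deriv x n (k + 1)) i j *
                falling_factorial_basis x k i.+1 t].
Proof.
rewrite !addn1; split=> [le_jk lt_jn|bd|le_nj lt_kj|t tab].
- move=> t tab tC; apply: (dbspline_eq0_right hx hN) => //; first by lia.
  by move: tab tC; rewrite !in_itv /= => /andP[-> _] /=; rewrite -ltNge.
- rewrite subn1 /= => t tab; rewrite in_itv /= negb_and -!ltNge.
  case/orP => lt_t.
    by apply: (dbspline_eq0_left hx hN) => //; lia.
  by apply: (dbspline_eq0_right hx hN) => //; lia.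
- rewrite subn1 /= => t tab tC; apply: (dbspline_eq0_left hx hN) => //.
  by move: tab tC; rewrite !in_itv /= => /andP[_ ->]; rewrite andbT -ltNge.
- rewrite (dbspline_expansion hx hN) //; apply: eq_bigl => i.
  by have := ltn_ord i; lia.
Qed.
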